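(* Consider a framed, miniversal family of finite, integral, uncoupled BPS structures over a complex manifold $M$, with the notation of the context, and the section $M\subset X=T_M$ determined by fixing the constant term $\xi$. Let $\tau|_M$ be the restriction to this section of the associated Joyce structure $\tau$-function, defined using $\Theta_0=\sum_{i=1}^d\omega_{i,i+d}\,z_i\,dz_{i+d}$ and $\Theta_1=\sum_{i=1}^d\omega_{i,i+d}\,x_i\,dx_{i+d}$. Then $$d\log(\tau|_M)=\epsilon^{-1}\sum_{i=1}^d\omega_{i,i+d}\,z_i\,dy_{i+d},$$ and for $1\le i\le d$ $$\frac{\partial}{\partial z_i}\log(\tau|_M)=-\omega_{i,i+d}\,\frac{\partial y_{i+d}}{\partial\epsilon},\qquad \frac{\partial}{\partial z_{i+d}}\log(\tau|_M)=0.$$ That is, $\tau|_M$ satisfies the defining equations of, and hence coincides with, the BPS $\tau$-function described in the context.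
   Context: Data: $\Gamma\cong\mathbb{Z}^{\oplus n}$, $n=2d$, is a fixed lattice with a skew-symmetric integral form $\langle-,-\rangle$. At each point $p\in M$ there is a BPS structure given by a central charge homomorphism $Z_p\colon\Gamma\to\mathbb{C}$ and BPS invariants $\Omega_p(\gamma)\in\mathbb{Q}$ for $\gamma\in\Gamma$. Miniversal: for a basis $(\gamma_i)$ of $\Gamma$ the functions $z_i=Z(\gamma_i)$ are local co-ordinates on $M$. Finite: only finitely many $\Omega_p(\gamma)$ are nonzero for each $p$. Integral: $\Omega_p(\gamma)\in\mathbb{Z}$ for generic $p$. Uncoupled: $\Omega_p(\gamma_i)\ne0$ for $i=1,2$ implies $\langle\gamma_1,\gamma_2\rangle=0$. In this case $\Omega_p(\gamma)=\Omega(\gamma)$ is independent of $p$, and one takes a basis $(\gamma_1,\dots,\gamma_{2d})$ with $\langle\gamma_i,\gamma_j\rangle=0$ unless $|j-i|=d$, and such that $\Omega(\gamma)\neq0$ implies $\gamma\in\bigoplus_{i=1}^d\mathbb{Z}\gamma_i$. Set $\eta_{ij}=2\pi i\langle\gamma_i,\gamma_j\rangle$ (assumed invertible), and let $(\omega_{ij})$ be the inverse matrix, so that $\omega_{i,i+d}\,\eta_{i,i+d}=-1$ for $1\le i\le d$. The symplectic form on $M$ is $\Omega_0=\sum_{i=1}^d\omega_{i,i+d}\,dz_i\wedge dz_{i+d}$. Solution of the associated Riemann–Hilbert problem: fix a twisted character $\xi\colon\Gamma\to\mathbb{C}^*$ (the constant term) with $\xi(\gamma_i)=1$ for $1\le i\le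 d$. The Riemann–Hilbert problem attached to the BPS structure has a unique solution $X_i=\exp(x_i)$ with $$x_i=-\epsilon^{-1}z_i+y_i,\qquad y_i=\sum_{\gamma\in\Gamma}\Omega(\gamma)\,\langle\gamma,\gamma_i\rangle\,\log\Lambda\!\left(\frac{Z(\gamma)}{2\pi i\epsilon}\right),\qquad \Lambda(w)=\frac{e^w\,\Gamma(w)}{\sqrt{2\pi}\,w^{w-\frac12}},$$ where $\Gamma(w)$ is the gamma function, all functions being considered locally in $(z,\epsilon)$, with $\epsilon\in\mathbb{C}^*$, where they are defined. In particular $y_i=0$ for $1\le i\le d$. BPS $\tau$-function: a locally-defined function $\tau\colon M\to\mathbb{C}^*$ (depending also on $\epsilon$) satisfying, for $1\le i\le d$, $$\frac{\partial}{\partial z_i}\log(\tau)=-\omega_{i,i+d}\frac{\partial y_{i+d}}{\partial\epsilon},\qquad\frac{\partial}{\partial z_{i+d}}\log(\tau)=0,$$ and homogeneous under simultaneous rescaling of all $z_i$ and $\epsilon$. It is considered up to multiplication by a nonzero constant. Joyce structure $\tau$-function: on $X=T_M$ with co-ordinates $(z_i,\theta_j)$ (tangent vectors written $\sum_i\theta_i\partial/\partial z_i$) set $2i\Theta_I=-\sum_{p,q}\omega_{pq}\,z_p\,d\theta_q$. The functions $x_i$ are the preferred Darboux co-ordinates on the twistor fibre of the associated Joyce structure, viewed (after pulling back by the $\mathbb{C}^*$-action rescaling the $z_i$) as functions of $z$ and $\epsilon$, and their restrictions to the section of $X\to M$ on which $\xi$ (equivalently all $\theta_j$) is constant are the functions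 given above. Fixing the $\xi(\gamma_i)=1$, $1\le i\le d$, amounts to restricting to the inverse image of a Lagrangian in the twistor fibre at infinity, so that the contribution $\Theta_\infty$ of that fibre to the $\tau$-function is dropped. The restricted $\tau$-function is then the locally-defined function on this section, unique up to multiplication by constants and viewed as a function of $\epsilon^{-1}z$, satisfying for each $\epsilon$ $$d\log(\tau|_M)=\left.\left(\epsilon^{-2}\Theta_0+2i\epsilon^{-1}\Theta_I-\Theta_1\right)\right|_M,$$ where $d$ is the exterior derivative in the variables $z_i$ with $\epsilon$ fixed. *)

(* Defs.v *)
From HB Require Import structures.
From mathcomp Require Import all_boot all_order all_algebra.
From mathcomp Require Import complex.
From mathcomp Require Import all_classical all_reals all_analysis.

Set Implicit Arguments.
Unset Strict Implicit.
Unset Printing Implicit Defensive.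

Import Order.TTheory GRing.Theory Num.Theory.
Import numFieldNormedType.Exports.

Local Open Scope classical_set_scope.
Local Open Scope ring_scope.
Local Open Scope complex_scope.

(** The field R[i], as a numClosedFieldType so that it carries the normed
    module structure over itself given to every such field. *)
Definition Cplx (R : realType) : numClosedFieldType := R[i].

Section ComplexFunctions.
Context {R : realType}.
Local Notation C := (Cplx R).

Definition ofR (r : R) : C := r%:C.

Definition two_pi_i : C := ofR (2 * pi) * 'i.

Definition expC (z : C) : C :=
  ofR (expR (complex.Re z)) * (cos (complex.Im z) +i* sin (complex.Im z)).

(** Principal argument, in ]-pi, pi]. *)
Definition ArgC (w : C) : R :=
  let a := acos (complex.Re w / ComplexField.Normc.normc w) in
  if 0 <= complex.Im w then a else - a.

Definition LogC (w : C) : C := ofR (ln (ComplexField.Normc.normc w)) + 'i * ofR (ArgC w).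

(** The complex plane cut along the nonpositive reals: in the partial order of
    [R[i]], [w <= 0] says that [w] is a nonpositive real number. *)
Definition slit_plane : set C := [set w | ~~ (w <= 0)].

(** Gauss's limit: n! n^w / (w (w + 1) ... (w + n)) --> Gamma(w). *)
Definition GammaC (w : C) : C :=
  limn (fun n : nat => n`!%:R * expC (w * ofR (ln n%:R))
                       / \prod_(k < n.+1) (w + k%:R) : C).

(** Lambda(w) = e^w Gamma(w) / (sqrt(2 pi) w^(w - 1/2)), with the principal
    branch of the power. *)
Definition LambdaC (w : C) : C :=
  expC w * GammaC w
  / (ofR (Num.sqrt (2 * pi)) * expC ((w - 2^-1) * LogC w)).

(** A holomorphic branch of log Lambda on the cut plane. *)
Definition log_Lambda_branch (L : C -> C) : Prop :=
  forall w, slit_plane w -> differentiable L w /\ expC (L w) = LambdaC w.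

End ComplexFunctions.

Section Lattice.
Context {Gam : zmodType}.

Definition lattice_basis (n : nat) (b : 'I_n -> Gam) : Prop :=
  forall g, exists! a : {ffun 'I_n -> int}, g = \sum_i b i *~ a i.

Definition skew_form (form : Gam -> Gam -> int) : Prop :=
  (forall g1 g2 h, form (g1 + g2) h = form g1 h + form g2 h) /\
  (forall g h, form g h = - form h g).

End Lattice.

Record BPS_structure (R : realType) (Gam : zmodType) := BPSStructure {
  central_charge : {additive Gam -> Cplx R} ;
  BPS_invariant : Gam -> rat }.

Section Families.
Context {R : realType} {Gam : zmodType}.
Local Notation C := (Cplx R).

(** The framing is built in: the lattice and its form do not depend on the
    point of [M]. *)
Variables (form : Gam -> Gam -> int) (M : topologicalType).
Variable (F : M -> BPS_structure R Gam).

Definition finite_family : Prop :=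
  forall p, finite_set [set g | BPS_invariant (F p) g != 0].

Definition uncoupled_family : Prop :=
  forall p g1 g2, BPS_invariant (F p) g1 != 0 ->
    BPS_invariant (F p) g2 != 0 -> form g1 g2 = 0.

(** [p] is generic when active classes whose central charges lie on the same
    ray are orthogonal. *)
Definition generic_point (p : M) : Prop :=
  forall g1 g2, BPS_invariant (F p) g1 != 0 -> BPS_invariant (F p) g2 != 0 ->
    (exists2 r : R, 0 < r &
       central_charge (F p) g1 = ofR r * central_charge (F p) g2) ->
    form g1 g2 = 0.

Definition integral_family : Prop :=
  forall p, generic_point p -> forall g, BPS_invariant (F p) g \is a Num.int.

Section Coordinates.
Context {n : nat}.
Variable (b : 'I_n -> Gam).

Definition zcoord (p : M) : 'rV[C]_n := \row_i central_charge (F p) (b i).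

(** [phi] parametrizes an open subset of [M] by the values, in the open set
    [U], of the functions z_i = Z(gamma_i). *)
Definition coordinate_chart (U : set 'rV[C]_n) (phi : 'rV[C]_n -> M) : Prop :=
  [/\ open U, open (phi @` U), {within U, continuous phi},
      {within phi @` U, continuous zcoord} &
      forall u, U u -> zcoord (phi u) = u].

(** The z_i are local coordinates on [M]; the complex structure of [M] is the
    one for which they are holomorphic. *)
Definition miniversal : Prop :=
  forall p, exists U phi, coordinate_chart U phi /\ (phi @` U) p.

End Coordinates.
End Families.

Section TauFunctions.
Context {R : realType} {Gam : zmodType} {d : nat}.
Local Notation C := (Cplx R).
Local Notation V := 'rV[C]_(d + d).

Variables (form : Gam -> Gam -> int) (b : 'I_(d + d) -> Gam).

(** gamma_i and gamma_(i+d), for i in [0, d[. *)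
Local Notation lo i := (lshift d i).
Local Notation hi i := (rshift d i).

Definition adapted_basis (Om : Gam -> rat) : Prop :=
  [/\ lattice_basis b,
      forall i j : 'I_(d + d), (i + d != j)%N -> (j + d != i)%N ->
        form (b i) (b j) = 0 &
      forall g, Om g != 0 ->
        exists a : 'I_d -> int, g = \sum_i b (lo i) *~ a i].

Definition eta_mx : 'M[C]_(d + d) :=
  \matrix_(i, j) (two_pi_i * (form (b i) (b j))%:~R).

Definition omega_mx : 'M[C]_(d + d) := invmx eta_mx.

Definition twisted_character (xi : Gam -> C) : Prop :=
  (forall g, xi g != 0) /\
  (forall g h, xi (g + h) = (-1) ^ form g h * xi g * xi h).

(** A base point [xi0] of the torsor of twisted characters identifies the
    coordinates theta_j with xi(gamma_j) = xi0(gamma_j) exp(theta_j), so that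
    fixing [xi] amounts to fixing all theta_j. *)
Definition constant_term (xi0 xi : Gam -> C) (theta : V) : Prop :=
  [/\ twisted_character xi0, twisted_character xi,
      forall i : 'I_d, xi (b (lo i)) = 1 &
      forall j, xi (b j) = xi0 (b j) * expC (theta 0 j)].

(** y_i(z, epsilon), for a central charge [Z] depending on z. *)
Definition y_fun (Om : Gam -> rat) (L : C -> C) (Z : V -> Gam -> C)
    (i : 'I_(d + d)) (z : V) (e : C) : C :=
  \sum_(g \in [set: Gam])
    ratr (Om g) * (form g (b i))%:~R * L (Z z g / (two_pi_i * e)).

(** A 1-form on an open subset of [E] is a function of a point and a tangent
    vector. *)
Definition pullback (E E' : normedModType C) (s : E -> E')
    (alpha : E' -> E' -> C) : E -> E -> C :=
  fun z v => alpha (s z) ('d s z v).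

(** d log f at z is the linear form [alpha]; no branch of log f is needed,
    since d log f = f^-1 df. *)
Definition has_dlog (E : normedModType C) (f : E -> C) (z : E)
    (alpha : E -> C) : Prop :=
  differentiable f z /\ forall v, (f z)^-1 * 'd f z v = alpha v.

(** (partial / partial z_i) log f = a at z. *)
Definition has_partial_log (f : V -> C) (i : 'I_(d + d)) (z : V) (a : C)
    : Prop :=
  derivable f z (delta_mx 0 i) /\ (f z)^-1 * 'D_(delta_mx 0 i) f z = a.

(** On X = T_M with coordinates (z, theta), dz_i and dtheta_j evaluate on a
    tangent vector [v] to [v.1 0 i] and [v.2 0 j]. *)
Local Notation X := (V * V)%type.

Definition Theta_0 (p v : X) : C :=
  \sum_(i < d) omega_mx (lo i) (hi i) * p.1 0 (lo i) * v.1 0 (hi i).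

Definition Theta_I (p v : X) : C :=
  (2 * 'i)^-1 * (- \sum_j \sum_k omega_mx j k * p.1 0 j * v.2 0 k).

Definition Theta_1 (x : 'I_(d + d) -> X -> C -> C) (e : C) (p v : X) : C :=
  \sum_(i < d) omega_mx (lo i) (hi i) * x (lo i) p e
               * 'd (x (hi i) ^~ e) p v.

(** The section of X over M on which all theta_j are constant. *)
Definition theta_section (theta : V) (z : V) : X := (z, theta).

(** Joyce structure tau-function restricted to the section, on a domain [W] in
    the space of (z, epsilon). *)
Definition Joyce_tau (W : set (V * C)) (x : 'I_(d + d) -> X -> C -> C)
    (theta : V) (tau : V -> C -> C) : Prop :=
  [/\ forall z e, W (z, e) -> tau z e != 0,
      exists T : V -> C, forall z e, W (z, e) -> tau z e = T (e^-1 *: z) &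
      forall z e, W (z, e) ->
        has_dlog (tau ^~ e) z
          (pullback (theta_section theta)
             (fun p v => e ^- 2 * Theta_0 p v + 2 * 'i * e^-1 * Theta_I p v
                         - Theta_1 x e p v) z)].

(** BPS tau-function for given functions y_i(z, epsilon). *)
Definition BPS_tau (W : set (V * C)) (y : 'I_(d + d) -> V -> C -> C)
    (tau : V -> C -> C) : Prop :=
  [/\ forall z e, W (z, e) -> tau z e != 0,
      forall z e, W (z, e) -> forall i : 'I_d,
        has_partial_log (tau ^~ e) (lo i) z
          (- omega_mx (lo i) (hi i) * derive1 (y (hi i) z) e),
      forall z e, W (z, e) -> forall i : 'I_d,
        has_partial_log (tau ^~ e) (hi i) z 0 &
      forall z e c, c != 0 -> W (z, e) -> W (c *: z, c * e) ->
        tau (c *: z) (c * e) = tau z e].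

End TauFunctions.

Arguments eta_mx R {Gam d} form b.
Arguments omega_mx R {Gam d} form b.

(* Main.v *)
From HB Require Import structures.
Require Import Defs.
From mathcomp Require Import all_boot all_order all_algebra.
From mathcomp Require Import complex finmap ring.
From mathcomp Require Import all_classical all_reals all_analysis.

(** On the section where all [theta_j] are constant, the differentials
    [dtheta_j] vanish, and with them the term [Theta_I]. Since
    [<gamma, gamma_i> = 0] for every active class [gamma] and [1 <= i <= d], one
    has [y_i = 0], that is [x_i = - e^-1 z_i]; expanding
    [x_i dx_(i+d) = - e^-1 z_i (- e^-1 dz_(i+d) + dy_(i+d))], the first term of
    [Theta_1] cancels [e^-2 Theta_0] and
    [e^-1 sum_i omega_(i,i+d) z_i dy_(i+d)] remains ([pullback_Joyce_form]).

    For the partial derivatives, let [w_g = Z(g) / (2 pi i e)] and let [L] be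
    the branch of log Lambda. The charge of an active class
    [g = sum_i a_i gamma_i] is linear in [z_1 .. z_d], and
    [<g, gamma_(i+d)> = a_i <gamma_i, gamma_(i+d)>], where
    [omega_(i,i+d) <gamma_i, gamma_(i+d)> = - 1 / (2 pi i)]. Inserting this in
    the form above turns it into
    [v |-> - sum_g Om(g) L'(w_g) w_g(z) w_g(v)] ([sum_omega_dy]). On the i-th
    coordinate vector the value is [- omega_(i,i+d) dy_(i+d) / de], because
    [w_g] is homogeneous of degree -1 in [e] ([omega_derive1_y]), and on the
    (i+d)-th one it is 0 ([log_tau_form_hi]).
    The homogeneity of [tau] holds because it is a function of [e^-1 z].

    Two solutions of the BPS equations have a quotient whose partial
    derivatives in the [z_i] vanish. It is constant on polydiscs at a fixed
    scale [e], and homogeneity extends this to nearby scales, so it is locally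
    constant on the connected set [W] ([BPS_tau_unique]). *)

Set Implicit Arguments.
Unset Strict Implicit.
Unset Printing Implicit Defensive.

Import Order.TTheory GRing.Theory Num.Theory.
Import numFieldNormedType.Exports.

Local Open Scope classical_set_scope.
Local Open Scope ring_scope.

(** * Differentials *)

(** The differential only depends on the germ of the function, although it is
    defined by choosing a linear map. *)
Lemma near_eq_is_diff (K : numFieldType) (V W : normedModType K)
  (f g : V -> W) (df : V -> W) (z : V) :
  (\forall u \near z, f u = g u) -> is_diff z g df -> is_diff z f df.
Proof.
move=> fg [dg dfE].
have fgz : f z = g z by apply: nbhs_singleton fg.
have key : f \o shift z = cst (f z) + 'd g z +o_ 0 id.
  apply/eqaddoP => _/posnumP[eps].
  have /eqaddoP/(_ eps%:num) := diff_locally dg.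
  move=> /(_ [gt0 of eps%:num]); apply: filter_app.
  have : \forall h \near 0, f (h + z) = g (h + z).
    by move: fg; rewrite (near_shift 0) /= subr0.
  apply: filter_app; near=> h => /= fgh.
  by rewrite /= !fctE /= fgh fgz.
have dE : 'd f z = 'd g z :> (V -> W) by apply: (diff_unique _ key); exact: diff_continuous.
split; last by rewrite dE dfE.
apply/diff_locallyP; rewrite dE; split=> //; exact: diff_continuous.
Unshelve. all: by end_near. Qed.

Lemma is_diff_sum_seq (K : numFieldType) (V W : normedModType K) (I : eqType)
    (s : seq I) (f df : I -> V -> W) (z : V) :
  (forall i, i \in s -> is_diff z (f i) (df i)) ->
  is_diff z (fun u => \sum_(i <- s) f i u) (fun v => \sum_(i <- s) df i v).
Proof.
elim: s => [|i s IH] fdf.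
  under eq_fun do rewrite big_nil.
  by apply: is_diff_eq; apply/funext => v; rewrite big_nil.
under eq_fun do rewrite big_cons.
under [X in is_diff _ _ X]eq_fun do rewrite big_cons.
apply: is_diffD; first by apply: fdf; rewrite mem_head.
by apply: IH => j js; apply: fdf; rewrite inE js orbT.
Qed.

Lemma is_diff_comp_derive1 (K : numFieldType) (V : normedModType K)
    (L : K -> K) (h dh : V -> K) (z : V) (c : K) :
  differentiable L (h z) -> is_diff z h dh ->
  is_diff z (fun u => c * L (h u)) (fun v => c * (derive1 L (h z) * dh v)).
Proof.
move=> dL hdh.
have H : is_diff (h z) L (fun k => k *: derive1 L (h z)).
  by split=> //; rewrite diff1E.
have := @is_diffZ _ _ _ (L \o h) _ c z (@is_diff_comp _ _ _ _ _ _ _ _ _ hdh H).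
move=> /is_diff_eq; apply; apply/funext => v /=.
by rewrite /GRing.scale /= [dh v * _]mulrC.
Qed.

Lemma is_diff_coord (K : numFieldType) (m n : nat) (z : 'M[K]_(m, n))
    (i : 'I_m) (j : 'I_n) :
  is_diff z (fun u : 'M[K]_(m, n) => u i j : K) (fun v => v i j).
Proof.
have lin : linear (fun u : 'M[K]_(m, n) => u i j : K) by move=> ? ? ?; rewrite !mxE.
pose f : {linear 'M[K]_(m, n) -> K} :=
  HB.pack (fun u : 'M[K]_(m, n) => u i j : K) (GRing.isLinear.Build _ _ _ _ _ lin).
have cf : continuous f by exact: coord_continuous.
split; first exact: differentiable_coord.
exact: (diff_lin z cf).
Qed.

Lemma is_diff_divl (K : numFieldType) (c e : K) : e != 0 ->
  is_diff e (fun u : K => c / u) (fun h => - (c / e) / e * h).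
Proof.
move=> e0.
have H : is_diff e (fun u : K => u^-1) ( *:%R (- e ^- 2)).
  by split; [exact: differentiable_Rinv|exact: diff_Rinv].
apply: is_diff_eq (is_diffZ c H) _.
by apply/funext => h; rewrite /= !fctE /GRing.scale /=; field.
Qed.

Lemma nbhs_slice (K : numFieldType) (V : normedModType K) (W : set (V * K))
    (z : V) (e : K) :
  open W -> W (z, e) -> \forall u \near z, W (u, e).
Proof.
move=> Wo Wze.
have /nbhs_ballP [r /= r0 rW] : nbhs (z, e) W by exact: open_nbhs_nbhs.
apply/nbhs_ballP; exists r => // u zu; apply: rW; split=> //; exact: ballxx.
Qed.

Lemma is_diff_slice (K : numFieldType) (V V' : normedModType K) (t : V') (z : V) :
  is_diff z (fun u : V => (u, t)) (fun v => (v, 0)).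
Proof. exact: (is_diff_pair (is_diff_id z) (is_diff_cst t z)). Qed.

Lemma diff_along_slice (K : numFieldType) (V V' W : normedModType K)
    (f : V * V' -> W) (g dg : V -> W) (t : V') (z v : V) :
  differentiable f (z, t) -> (\forall u \near z, f (u, t) = g u) ->
  is_diff z g dg -> 'd f (z, t) (v, 0) = dg v.
Proof.
move=> df fg dg_.
have [ds dsE] := is_diff_slice t z.
have [_ <-] : is_diff z (f \o (fun u => (u, t))) dg by exact: near_eq_is_diff dg_.
by rewrite (diff_comp ds df) /comp dsE.
Qed.

Lemma is_derive_ratio0 (K : numFieldType) (V : normedModType K)
    (f g : V -> K) (z v : V) (a : K) :
  f z != 0 -> g z != 0 -> derivable f z v -> derivable g z v ->
  (f z)^-1 * 'D_v f z = a -> (g z)^-1 * 'D_v g z = a ->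
  is_derive z v (fun u => f u * (g u)^-1) 0.
Proof.
move=> fz gz df dg fa ga.
have dV : is_derive z v (fun u => (g u)^-1) (- (g z) ^- 2 *: 'D_v g z).
  by split; [exact: derivableV|exact: deriveV].
have := is_deriveM (derivableP df) dV.
move=> /is_derive_eq; apply; rewrite /GRing.scale /=.
have -> : 'D_v f z = f z * a by rewrite -fa mulVKf.
have -> : 'D_v g z = g z * a by rewrite -ga mulVKf.
by field.
Qed.

(** * Functions with vanishing partial derivatives *)

Section VanishingDerivatives.
Variable R : realType.
Local Notation C := (Cplx R).

(** No mean value theorem holds for complex values; composing with the real or
    the imaginary part, an additive map of norm at most one, gives a real
    function of the real parameter [t], to which it applies. The increment of
    that function at [t] is bounded by the one of [f] along [s * c], so it is
    negligible with respect to [s]. *)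
Lemma is_derive0_segment_part (rho : C -> R) (V : normedModType C)
    (f : V -> C) (a v : V) (c : C) :
  (forall w w', rho (w - w') = rho w - rho w') ->
  (forall w, ofR `|rho w| <= `|w|) ->
  (forall t : R, 0 <= t <= 1 -> is_derive (a + (ofR t * c) *: v) v f 0) ->
  rho (f (a + c *: v)) = rho (f a).
Proof.
move=> rhoB rho_le df.
pose h (t : R) : R := rho (f (a + (ofR t * c) *: v)).
have dh (t : R) : 0 <= t <= 1 -> is_derive t 1 h 0.
  move=> t01; have [dft dft0] := df t t01.
  set u := a + _ in dft dft0.
  suff H : (fun s => s^-1 *: ((h \o shift t) (s *: 1) - h t)) @ 0^' --> (0 : R).
    by split; [apply/cvg_ex; exists 0|apply: cvg_lim].
  apply/cvgr0Pnorm_le => e e0.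
  have {}H := derivable_nbhs dft; rewrite dft0 in H.
  have [c0|c0] := eqVneq c 0.
    near=> s; rewrite /h /= c0 !mulr0 subrr scaler0 normr0; exact: ltW.
  have e'0 : (0 : C) < ofR e / `|c|.
    by rewrite divr_gt0 ?normr_gt0 // ltcR.
  move/eqaddoP : H => /(_ _ e'0) /nbhs_ballP [r /= r0 Hr].
  (* Positive elements of the complex field are real, so the radius of
     differentiability and the norm of [c] can be compared with [s]. *)
  have [r' r'E] : exists r' : R, r = ofR r'.
    by exists (complex.Re r); rewrite /ofR RRe_real // gtr0_real.
  have r'0 : 0 < r' by move: r0; rewrite r'E ltcR.
  have nc0 : 0 < complex.Re `|c| :> R.
    have : (0 : C) < `|c| by rewrite normr_gt0.
    by rewrite ltcE => /andP[].
  have ncE : `|c| = ofR (complex.Re `|c|).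
    by rewrite /ofR RRe_real // normr_real.
  near=> s.
  have s0 : s != 0 by near: s; exact: nbhs_dnbhs_neq.
  have sr : `|s| < r' / complex.Re `|c|.
    near: s; apply: dnbhs0_lt; exact: divr_gt0.
  have nsE : `|ofR s| = ofR `|s| by rewrite normc_def /= expr0n /= addr0 sqrtr_sqr.
  have /Hr : ball (0 : C) r (ofR s * c).
    rewrite -ball_normE /= sub0r normrN normrM nsE ncE -rmorphM /= r'E ltcR.
    by rewrite -ltr_pdivlMr.
  rewrite !fctE scaler0 addr0 /= => Hs.
  rewrite normrZ normfV ler_pdivrMl ?normr_gt0 //.
  rewrite /h /= -rhoB -lecR.
  have -> : a + (ofR (s%:A + t) * c) *: v = (ofR s * c) *: v + u.
    by rewrite /u [s%:A]mulr1 /ofR rmorphD /= mulrDl scalerDl addrCA.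
  apply: le_trans (rho_le _) _; apply: le_trans Hs _.
  rewrite normrM nsE mulrC mulrAC mulrA divfK ?normr_eq0 //.
  have -> : ofR `|s| * ofR e = ofR (`|s| * e) by rewrite /ofR -rmorphM.
  exact: lexx.
have hc : {within `[0, 1], continuous h}.
  apply: derivable_within_continuous => t; rewrite in_itv /= => t01.
  by have [] := dh t t01.
have [|t _] := @MVT_segment R h (cst 0) 0 1 ler01 _ hc.
  by move=> t; rewrite in_itv /= => /andP[/ltW ? /ltW ?]; apply: dh; apply/andP.
rewrite /cst mul0r => /subr0_eq; rewrite /h.
by rewrite /ofR /= !(rmorph0, rmorph1) mul1r mul0r scale0r addr0.
Unshelve. all: by end_near. Qed.

Lemma is_derive0_segment (V : normedModType C) (f : V -> C) (a v : V) (c : C) :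
  (forall t : R, 0 <= t <= 1 -> is_derive (a + (ofR t * c) *: v) v f 0) ->
  f (a + c *: v) = f a.
Proof.
move=> df; apply/eqP; rewrite eq_complex; apply/andP; split; apply/eqP.
  apply: (@is_derive0_segment_part (@complex.Re R)) df => [[? ?] [? ?] //|w].
  exact: normc_ge_Re.
apply: (@is_derive0_segment_part (@complex.Im R)) df => [[? ?] [? ?] //|w].
rewrite -normrN -ReiNIm; apply: le_trans (normc_ge_Re _) _.
rewrite normrM [X in _ * X <= _](_ : _ = 1) ?mulr1 //.
by rewrite normc_def /= expr0n /= add0r expr1n sqrtr1.
Qed.

(** Balls are polydiscs, so changing one coordinate at a time leads from [z] to
    [u] along segments that stay in the ball. This works with partial
    derivatives alone, which is all that the BPS equations provide. *)
Lemma zero_partials_ball_cst (n : nat) (f : 'rV[C]_n -> C) (z : 'rV[C]_n)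
    (r : C) :
  (forall u, ball z r u -> forall i, is_derive u (delta_mx 0 i) f 0) ->
  forall u, ball z r u -> f u = f z.
Proof.
move=> df u [r0 zu].
pose mix (k : nat) : 'rV[C]_n := \row_i (if (i < k)%N then u 0 i else z 0 i).
suff H k : (k <= n)%N -> f (mix k) = f z.
  rewrite -(H n (leqnn n)); congr f; apply/rowP => i.
  by rewrite mxE ltn_ord.
elim: k => [_|k IH kn].
  by congr f; apply/rowP => i; rewrite mxE.
rewrite -(IH (ltnW kn)).
pose i0 := Ordinal kn.
have -> : mix k.+1 = mix k + (u 0 i0 - z 0 i0) *: delta_mx 0 i0.
  apply/rowP => i; rewrite !mxE eqxx /= ltnS leq_eqVlt.
  have [->|ii0] := eqVneq i i0; first by rewrite eqxx ltnn /= mulr1 addrC subrK.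
  rewrite (_ : (i == k :> nat) = false) /= ?mulr0 ?addr0 //.
  by apply/negbTE; apply: contra ii0 => /eqP ik; apply/eqP/val_inj.
apply: is_derive0_segment => t /andP[t0 t1]; apply: df.
split=> // i j; rewrite !mxE ord1 eqxx /=.
have [->|ii0] := eqVneq j i0; last first.
  by rewrite mulr0 addr0; case: ifP => _; [rewrite -(ord1 i); exact: zu|exact: ballxx].
have := zu 0 i0; rewrite -!ball_normE /= ltnn mulr1 opprD addNKr normrN normrM.
rewrite distrC; apply: le_lt_trans; rewrite ler_piMl ?normr_ge0 //.
by rewrite ger0_norm /ofR ?lecR // -[1]/(1%:C)%C lecR.
Qed.

(** The level sets of [q] in [W] are open, hence also relatively closed. *)
Lemma connected_locally_cst (T : topologicalType) (S : Type) (W : set T)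
    (q : T -> S) :
  open W -> connected W -> (forall w, W w -> \forall w' \near w, q w' = q w) ->
  forall w w', W w -> W w' -> q w' = q w.
Proof.
move=> Wo Wc ql w w' Ww Ww'.
have op (P : S -> Prop) : open (W `&` [set u | P (q u)]).
  rewrite openE => u [Wu Pu]; rewrite /interior; near=> v.
  split; first by near: v; exact: open_nbhs_nbhs.
  rewrite /= (_ : q v = q u) //; near: v; exact: ql.
pose B := W `&` [set u | q u = q w].
suff BW : B = W by have [] : B w' by rewrite BW.
apply: Wc; first by exists w.
    by exists B; [exact: (op (fun s => s = q w))|rewrite /B setIA setIid].
  exists (~` (W `&` [set u | q u <> q w])).
    by apply: open_closedC; exact: (op (fun s => s <> q w)).
  rewrite eqEsubset; split=> u [Wu qu]; split=> //; first by case.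
  by apply: contrapT => qn; apply: qu.
Unshelve. all: by end_near. Qed.

(** By homogeneity [q u e'] is the value of [q] at scale [e] of the rescaled
    point [(e / e') *: u], which is close to [z], so the previous
    constancy at scale [e] applies to it. *)
Lemma homogeneous_locally_cst (n : nat) (W : set ('rV[C]_n * C))
    (q : 'rV[C]_n -> C -> C) (p : 'rV[C]_n * C) :
  open W -> (forall z e, W (z, e) -> e != 0) ->
  (forall z e, W (z, e) -> forall i, is_derive z (delta_mx 0 i) (q ^~ e) 0) ->
  (forall z e c, c != 0 -> W (z, e) -> W (c *: z, c * e) ->
     q (c *: z) (c * e) = q z e) ->
  W p -> \forall w \near p, q w.1 w.2 = q p.1 p.2.
Proof.
move=> Wo We dq qh Wp; set z := p.1; set e := p.2.
have Wze : W (z, e) by rewrite -surjective_pairing.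
have e0 := We _ _ Wze.
have /nbhs_ballP [r /= r0 rW] : nbhs p W by exact: open_nbhs_nbhs.
have Wb u : ball z r u -> W (u, e).
  by move=> zu; apply: rW; split=> //; exact: ballxx.
have qb u : ball z r u -> q u e = q z e.
  move=> zu; apply: (@zero_partials_ball_cst n (q ^~ e) z r _ u zu) => v /Wb Wv.
  exact: dq.
have cv : (fun w : 'rV[C]_n * C => (e / w.2) *: w.1) @ p --> z.
  rewrite -[X in _ --> X]scale1r -(divff e0).
  apply: cvgZ; last exact: cvg_fst.
  by apply: cvgM; [exact: cvg_cst|apply: cvgV => //; exact: cvg_snd].
have nz : nbhs z (ball z r) by exact: nbhsx_ballx.
have nW : nbhs p W by exact: open_nbhs_nbhs.
have nb := cv _ nz; rewrite nbhs_simpl /= in nb.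
apply: filterS (@filterI _ (nbhs p) (nbhs_filter p) _ _ nW nb).
move=> -[u e'] [Ww wb] /=.
have w0 : e / e' != 0 by rewrite mulf_neq0 ?invr_eq0 // (We _ _ Ww).
have ee : e / e' * e' = e by rewrite divfK // (We _ _ Ww).
have Wu : W ((e / e') *: u, e / e' * e') by rewrite ee; exact: Wb.
by rewrite -(qb _ wb) -(qh u e' (e / e')) //= ee.
Qed.

End VanishingDerivatives.

(** The quotient [sigma / tau] has vanishing partial derivatives and is
    homogeneous, hence locally constant, and [W] is connected. *)
Lemma BPS_tau_unique (R : realType) (d : nat) (Gam : zmodType)
    (form : Gam -> Gam -> int) (b : 'I_(d + d) -> Gam)
    (W : set ('rV[Cplx R]_(d + d) * Cplx R))
    (y : 'I_(d + d) -> 'rV[Cplx R]_(d + d) -> Cplx R -> Cplx R)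
    (tau sigma : 'rV[Cplx R]_(d + d) -> Cplx R -> Cplx R) :
  open W -> connected W -> (forall z e, W (z, e) -> e != 0) ->
  BPS_tau form b W y tau -> BPS_tau form b W y sigma ->
  exists2 c : Cplx R, c != 0 &
    forall z e, W (z, e) -> sigma z e = c * tau z e.
Proof.
move=> Wo Wc We [t0 tlo thi th] [s0 slo shi sh].
have [[[z0 e0] W0]|/forallNP W0] := pselect (exists w, W w); last first.
  by exists 1 => [|z e /W0 //]; exact: oner_neq0.
pose q z e := sigma z e * (tau z e)^-1.
have partial z e i : W (z, e) -> exists a : Cplx R,
    has_partial_log (tau ^~ e) i z a /\ has_partial_log (sigma ^~ e) i z a.
  move=> Wze; case: (split_ordP i) => j ->.
    by eexists; split; [exact: tlo|exact: slo].
  by eexists; split; [exact: thi|exact: shi].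
have dq z e : W (z, e) -> forall i, is_derive z (delta_mx 0 i) (q ^~ e) 0.
  move=> Wze i; have [a [[dt ta] [ds sa]]] := partial z e i Wze.
  have tz := t0 _ _ Wze; have sz := s0 _ _ Wze.
  exact: (is_derive_ratio0 sz tz ds dt sa ta).
have qh z e c : c != 0 -> W (z, e) -> W (c *: z, c * e) ->
    q (c *: z) (c * e) = q z e.
  by move=> c0 W1 W2; rewrite /q th // sh.
have ql w : W w -> \forall w' \near w, q w'.1 w'.2 = q w.1 w.2.
  by move=> Ww; exact: homogeneous_locally_cst.
exists (q z0 e0); first by rewrite mulf_neq0 ?invr_eq0 ?s0 ?t0.
move=> z e Wze.
have := @connected_locally_cst _ _ W (fun w => q w.1 w.2) Wo Wc ql _ _ W0 Wze.
by move=> /= <-; rewrite /q divfK // t0.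
Qed.

(** * The lattice and its form *)

Section Lattice.
Variables (Gam : zmodType) (form : Gam -> Gam -> int).
Hypothesis form_skew : skew_form form.

Lemma skew_form_sumZ (n : nat) (b : 'I_n -> Gam) (a : 'I_n -> int) (h : Gam) :
  form (\sum_i b i *~ a i) h = \sum_i a i * form (b i) h.
Proof.
have fB : zmod_morphism (fun g => form g h).
  have fN g : form (- g) h = - form g h.
    have f0 : form 0 h = 0 by apply: (addIr (form 0 h)); rewrite -form_skew.1 !add0r.
    by apply: (addIr (form g h)); rewrite -form_skew.1 !addNr.
  by move=> g g'; rewrite form_skew.1 fN.
pose fh : {additive Gam -> int} :=
  HB.pack (fun g => form g h) (GRing.isZmodMorphism.Build _ _ _ fB).
rewrite -[LHS]/(fh _) raddf_sum; apply: eq_bigr => i _.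
by rewrite raddfMz mulrzz mulrC.
Qed.

Variables (d : nat) (b : 'I_(d + d) -> Gam) (Om : Gam -> rat).
Hypothesis b_adapted : adapted_basis form b Om.
Local Notation lo i := (lshift d i).
Local Notation hi i := (rshift d i).

Lemma form_lo_lo (i j : 'I_d) : form (b (lo i)) (b (lo j)) = 0.
Proof.
have [_ bo _] := b_adapted.
by apply: bo; rewrite /= gtn_eqF // ltn_addl.
Qed.

Lemma form_lo_hi (i j : 'I_d) : i != j -> form (b (lo i)) (b (hi j)) = 0.
Proof.
have [_ bo _] := b_adapted => ij.
apply: bo => /=; first by rewrite addnC eqn_add2l.
by rewrite gtn_eqF // ltn_addl // ltn_addr.
Qed.

(** The active classes span an isotropic sublattice; this makes the first [d]
    of the functions [y_i] vanish. *)
Lemma form_span_lo (a : 'I_d -> int) (k : 'I_d) :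
  form (\sum_i b (lo i) *~ a i) (b (lo k)) = 0.
Proof. by rewrite skew_form_sumZ big1 // => i _; rewrite form_lo_lo mulr0. Qed.

Lemma form_span_hi (a : 'I_d -> int) (k : 'I_d) :
  form (\sum_i b (lo i) *~ a i) (b (hi k)) = a k * form (b (lo k)) (b (hi k)).
Proof.
rewrite skew_form_sumZ (bigD1 k) //= big1 ?addr0 // => i ik.
by rewrite form_lo_hi ?mulr0.
Qed.

(** The row of [eta] at [gamma_(k+d)] has a single nonzero entry, in column
    [gamma_k], so up to sign this is a diagonal entry of [eta * omega]. *)
Lemma omega_eta_lo_hi (R : realType) (k : 'I_d) :
  eta_mx R form b \in unitmx ->
  omega_mx R form b (lo k) (hi k)
    * (two_pi_i * (form (b (lo k)) (b (hi k)))%:~R) = -1.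
Proof.
move=> eta_unit; have [_ bo _] := b_adapted.
have := mulmxV eta_unit => /matrixP /(_ (hi k) (hi k)).
rewrite !mxE eqxx (bigD1 (lo k)) //= big1 => [|j jk].
  rewrite addr0 mxE form_skew.2 mulrNz mulrN mulNr mulrC => /eqP.
  by rewrite eqr_oppLR => /eqP.
rewrite mxE bo ?mulr0z ?mulr0 ?mul0r //=.
  by rewrite gtn_eqF // addnAC ltn_addr.
apply: contra jk => /eqP jk; apply/eqP/val_inj => /=.
by apply/eqP; rewrite -(eqn_add2r d) jk addnC.
Qed.
End Lattice.

(** * The functions y_i and their derivatives *)

Section LocalForm.
Context {R : realType} {d : nat} {Gam : zmodType} {form : Gam -> Gam -> int}.
Local Notation C := (Cplx R).
Local Notation V := 'rV[C]_(d + d).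
Local Notation lo i := (lshift d i).
Local Notation hi i := (rshift d i).

(** The central charge of the class with coordinates [a] in the isotropic
    sublattice, as a linear function of the coordinates [z]. *)
Definition span_charge (a : 'I_d -> int) (z : V) : C :=
  \sum_i (a i)%:~R * z 0 (lo i).

Lemma chart_charge (M : topologicalType) (F : M -> BPS_structure R Gam)
    (b : 'I_(d + d) -> Gam) (U : set V) (phi : V -> M) (a : 'I_d -> int) (z : V) :
  coordinate_chart F b U phi -> U z ->
  central_charge (F (phi z)) (\sum_i b (lo i) *~ a i) = span_charge a z.
Proof.
move=> [_ _ _ _ zK] Uz; rewrite raddf_sum; apply: eq_bigr => i _.
by rewrite raddfMz /= mulrzl; have /rowP/(_ (lo i)) := zK z Uz; rewrite mxE => ->.
Qed.

Lemma is_diff_span_charge (a : 'I_d -> int) (c : C) (z : V) :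
  is_diff z (fun u => span_charge a u / c) (fun v => span_charge a v / c).
Proof.
have H i : is_diff z (fun u : V => (a i)%:~R * u 0 (lo i)) (fun v => (a i)%:~R * v 0 (lo i)).
  exact: (is_diffZ (a i)%:~R (is_diff_coord z 0 (lo i))).
have := is_diffZ c^-1 (is_diff_sum_seq (s := index_enum 'I_d) (fun i _ => H i)).
have E : (c^-1 *: (fun u : V => \sum_(i <- index_enum 'I_d) (a i)%:~R * u 0 (lo i)))
  = fun u => span_charge a u / c by apply/funext => u; exact: mulrC.
by rewrite E.
Qed.

Lemma y_fun_finite (b : 'I_(d + d) -> Gam) (Om : Gam -> rat) (L : C -> C)
    (Z : V -> Gam -> C) (S : {fset Gam}) (i : 'I_(d + d)) (z : V) (e : C) :
  (forall g, Om g != 0 -> g \in S) ->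
  y_fun form b Om L Z i z e =
  \sum_(g <- S) ratr (Om g) * (form g (b i))%:~R * L (Z z g / (two_pi_i * e)).
Proof.
move=> SOm; rewrite /y_fun (fsbigTE S) // => g gS.
by have [->|/SOm] := eqVneq (Om g) 0; rewrite ?rmorph0 ?mul0r // (negbTE gS).
Qed.

Variables (b : 'I_(d + d) -> Gam) (Om : Gam -> rat) (L : C -> C)
  (M : topologicalType) (F : M -> BPS_structure R Gam)
  (U : set V) (phi : V -> M) (W : set (V * C))
  (S : {fset Gam}) (A : Gam -> 'I_d -> int).
Hypothesis form_skew : skew_form form.
Hypothesis b_adapted : adapted_basis form b Om.
Hypothesis eta_unit : eta_mx R form b \in unitmx.
Hypothesis phi_chart : coordinate_chart F b U phi.
Hypothesis L_diff : forall w, slit_plane w -> differentiable L w.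
Hypothesis W_sub : forall z e, W (z, e) -> U z /\ e != 0.
Hypothesis W_slit : forall z e, W (z, e) -> forall g, Om g != 0 ->
  slit_plane (central_charge (F (phi z)) g / (two_pi_i * e)).
Hypothesis S_active : forall g, (g \in S) = (Om g != 0).
Hypothesis A_span : forall g, g \in S -> g = \sum_i b (lo i) *~ A g i.

Local Notation y := (y_fun form b Om L (fun u => central_charge (F (phi u)))).
Local Notation om k := (omega_mx R form b (lo k) (hi k)).

Definition arg_Lambda (g : Gam) (z : V) (e : C) : C :=
  span_charge (A g) z / (two_pi_i * e).

Definition y_coef (g : Gam) (k : 'I_d) : C :=
  ratr (Om g) * (A g k * form (b (lo k)) (b (hi k)))%:~R.

(** The value of d log of both tau-functions at [z] in the direction [v], in a
    form in which the homogeneous and the differentiated argument of [Lambda]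
    enter symmetrically. *)
Definition log_tau_form (e : C) (z v : V) : C :=
  - \sum_(g <- S) ratr (Om g) * derive1 L (arg_Lambda g z e)
                  * arg_Lambda g z e * arg_Lambda g v e.

Lemma slit_arg_Lambda z e g : W (z, e) -> g \in S ->
  slit_plane (arg_Lambda g z e).
Proof.
move=> Wze gS; have [Uz _] := W_sub Wze.
rewrite /arg_Lambda -(chart_charge (A g) phi_chart Uz) -A_span //.
by apply: W_slit => //; rewrite -S_active.
Qed.

Lemma y_loE k z e : y (lo k) z e = 0.
Proof.
rewrite (@y_fun_finite _ _ _ _ S) => [|g]; last by rewrite S_active.
rewrite big_seq big1 // => g gS.
by rewrite (A_span gS) (form_span_lo form_skew b_adapted) mulr0 mul0r.
Qed.

Lemma y_hiE k z e : U z ->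
  y (hi k) z e = \sum_(g <- S) y_coef g k * L (arg_Lambda g z e).
Proof.
move=> Uz; rewrite (@y_fun_finite _ _ _ _ S) => [|g]; last by rewrite S_active.
rewrite big_seq [RHS]big_seq; apply: eq_bigr => g gS.
rewrite {2 3}(A_span gS) (form_span_hi form_skew b_adapted).
by rewrite (chart_charge _ phi_chart).
Qed.

Lemma is_diff_y_hi k z e : W (z, e) ->
  is_diff z (y (hi k) ^~ e)
    (fun v => \sum_(g <- S) y_coef g k
                * (derive1 L (arg_Lambda g z e) * arg_Lambda g v e)).
Proof.
move=> Wze; have [Uz _] := W_sub Wze.
apply: (@near_eq_is_diff _ _ _ _
  (fun u => \sum_(g <- S) y_coef g k * L (arg_Lambda g u e))).
  have [Uo _ _ _ _] := phi_chart.
  have : nbhs z U by exact: open_nbhs_nbhs.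
  by apply: filterS => u Uu; exact: y_hiE.
apply: is_diff_sum_seq => g gS; apply: is_diff_comp_derive1.
  by apply: L_diff; exact: slit_arg_Lambda.
exact: is_diff_span_charge.
Qed.

Lemma derive1_y_hi k z e : W (z, e) ->
  derive1 (y (hi k) z) e =
  \sum_(g <- S) y_coef g k
     * (derive1 L (arg_Lambda g z e) * (- arg_Lambda g z e / e)).
Proof.
move=> Wze; have [Uz e0] := W_sub Wze.
have argE g : arg_Lambda g z = fun u => span_charge (A g) z / two_pi_i / u.
  by apply/funext => u; rewrite /arg_Lambda invfM mulrA.
have -> : y (hi k) z = fun u => \sum_(g <- S) y_coef g k * L (arg_Lambda g z u).
  by apply/funext => u; exact: y_hiE.
have H : is_diff e (fun u => \sum_(g <- S) y_coef g k * L (arg_Lambda g z u))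
    (fun h => \sum_(g <- S) y_coef g k
       * (derive1 L (arg_Lambda g z e) * (- arg_Lambda g z e / e * h))).
  apply: is_diff_sum_seq => g gS; apply: is_diff_comp_derive1.
    by apply: L_diff; exact: slit_arg_Lambda.
  by rewrite argE; exact: is_diff_divl.
rewrite derive1E'; last exact: ex_diff.
by rewrite diff_val; apply: eq_bigr => g _; rewrite mulr1.
Qed.

(** Normalizes [omega] so that [2 pi i] cancels against the arguments of
    [Lambda]. *)
Lemma two_pi_i_omega_form k :
  two_pi_i^-1 = - (om k * (form (b (lo k)) (b (hi k)))%:~R).
Proof.
have H := omega_eta_lo_hi form_skew b_adapted k eta_unit.
have t0 : (two_pi_i : C) != 0.
  apply/eqP => t0; move/eqP: H.
  by rewrite t0 mul0r mulr0 eq_sym oppr_eq0 oner_eq0.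
apply: (mulfI t0); rewrite divff // mulrN mulrCA H opprK //.
Qed.

(** The coefficients [om k * <gamma_k, gamma_(k+d)>] are independent of [k], so
    the weighted sum over [k] of the coordinates of [g] rebuilds the charge of
    [g] at [z]. *)
Lemma sum_omega_dy z v e : W (z, e) ->
  e^-1 * \sum_(k < d) om k * z 0 (lo k) * 'd (y (hi k) ^~ e) z v =
  log_tau_form e z v.
Proof.
move=> Wze; have [_ e0] := W_sub Wze.
have dE k : om k * z 0 (lo k) * 'd (y (hi k) ^~ e) z v =
    \sum_(g <- S) om k * z 0 (lo k) * (y_coef g k
       * (derive1 L (arg_Lambda g z e) * arg_Lambda g v e)).
  by have [_ ->] := is_diff_y_hi k Wze; rewrite mulr_sumr.
under eq_bigr do rewrite dE.
rewrite exchange_big /log_tau_form mulr_sumr -sumrN; apply: eq_bigr => g _ /=.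
set l := derive1 L _; set av := arg_Lambda g v e.
rewrite /arg_Lambda /span_charge !(mulr_suml, mulr_sumr) -sumrN; apply: eq_bigr => k _.
rewrite invfM (two_pi_i_omega_form k) /y_coef intrM.
ring.
Qed.

(** Differentiating [w_g] in the scale gives the factor [- w_g / e], and the
    coefficient of [y_(k+d)] at [g] is the value of the linear form [w_g] on the
    k-th basis vector up to a constant. *)
Lemma omega_derive1_y z e k : W (z, e) ->
  - om k * derive1 (y (hi k) z) e = log_tau_form e z (delta_mx 0 (lo k)).
Proof.
move=> Wze; rewrite (derive1_y_hi k Wze) /log_tau_form mulr_sumr -sumrN.
apply: eq_bigr => g _.
have -> : arg_Lambda g (delta_mx 0 (lo k)) e = (A g k)%:~R / (two_pi_i * e).
  congr (_ / _); rewrite /span_charge (bigD1 k) //= big1 ?addr0 => [|i ik].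
    by rewrite mxE !eqxx mulr1.
  by rewrite mxE eq_lshift (negbTE ik) andbF mulr0.
rewrite invfM [two_pi_i^-1](two_pi_i_omega_form k) /y_coef intrM.
ring.
Qed.

(** The active charges only involve the first [d] coordinates. *)
Lemma log_tau_form_hi z e k : log_tau_form e z (delta_mx 0 (hi k)) = 0.
Proof.
rewrite /log_tau_form big1 ?oppr0 // => g _.
rewrite [X in _ * X](_ : _ = 0) ?mulr0 //.
rewrite /arg_Lambda /span_charge big1 ?mul0r // => i _.
by rewrite mxE eq_lrshift andbF mulr0.
Qed.

End LocalForm.

(** * The two tau-functions *)

(** Along the section all [dtheta_j] vanish, and the [e^-2] part of [Theta_1]
    cancels [Theta_0]: what is left is the cross term [z_i dy_(i+d)]. *)
Lemma pullback_Joyce_form (R : realType) (d : nat) (Gam : zmodType)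
    (form : Gam -> Gam -> int) (b : 'I_(d + d) -> Gam)
    (W : set ('rV[Cplx R]_(d + d) * Cplx R))
    (theta : 'rV[Cplx R]_(d + d))
    (x : 'I_(d + d) -> 'rV[Cplx R]_(d + d) * 'rV[Cplx R]_(d + d) ->
       Cplx R -> Cplx R)
    (y : 'I_(d + d) -> 'rV[Cplx R]_(d + d) -> Cplx R -> Cplx R)
    (z : 'rV[Cplx R]_(d + d)) (e : Cplx R) :
  open W -> W (z, e) ->
  (forall i, differentiable (x i ^~ e) (theta_section theta z)) ->
  (forall i u, W (u, e) ->
     x i (theta_section theta u) e = - e^-1 * u 0 i + y i u e) ->
  (forall k, y (lshift d k) z e = 0) ->
  (forall k, differentiable (y (rshift d k) ^~ e) z) ->
  forall v,
  pullback (theta_section theta)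
    (fun p v => e ^- 2 * Theta_0 form b p v + 2 * 'i * e^-1 * Theta_I form b p v
                - Theta_1 form b x e p v) z v =
  e^-1 * \sum_(k < d) omega_mx R form b (lshift d k) (rshift d k)
     * z 0 (lshift d k) * 'd (y (rshift d k) ^~ e) z v.
Proof.
move=> Wo Wze dx xE ylo dy v.
have [_ ds] : is_diff z (theta_section theta) (fun v => (v, 0)).
  exact: is_diff_slice.
have dsE w : 'd (theta_section theta) z w = (w, 0) by rewrite ds.
have dxE k w : 'd (x (rshift d k) ^~ e) (theta_section theta z) (w, 0) =
    - e^-1 * w 0 (rshift d k) + 'd (y (rshift d k) ^~ e) z w.
  have dg := is_diffD (is_diffZ (- e^-1) (is_diff_coord z 0 (rshift d k)))
                      (differentiableP (dy k)).
  apply: (diff_along_slice w (dx _) _ dg).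
  by apply: filterS (nbhs_slice Wo Wze) => u Wu; exact: xE.
rewrite /pullback dsE /Theta_0 /Theta_I /Theta_1 /=.
rewrite [X in - X]big1 => [|j _]; last first.
  by rewrite big1 // => k _; rewrite mxE mulr0.
rewrite oppr0 !mulr0 addr0 !mulr_sumr -sumrB; apply: eq_bigr => k _.
rewrite xE // ylo dxE -exprVn addr0.
ring.
Qed.

Theorem mainTheorem5 (R : realType) (d : nat) (Gam : zmodType)
  (form : Gam -> Gam -> int) (M : topologicalType)
  (F : M -> BPS_structure R Gam) (Om : Gam -> rat) (b : 'I_(d + d) -> Gam)
  (form_skew : skew_form form)
  (F_miniversal : miniversal F b)
  (F_finite : finite_family F)
  (F_integral : integral_family form F)
  (F_uncoupled : uncoupled_family form F)
  (F_constant : forall p g, BPS_invariant (F p) g = Om g)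
  (b_adapted : adapted_basis form b Om)
  (eta_invertible : eta_mx R form b \in unitmx)
  (U : set 'rV[Cplx R]_(d + d)) (phi : 'rV[Cplx R]_(d + d) -> M)
  (phi_chart : coordinate_chart F b U phi)
  (L : Cplx R -> Cplx R) (L_branch : log_Lambda_branch L)
  (W : set ('rV[Cplx R]_(d + d) * Cplx R))
  (W_open : open W) (W_connected : connected W)
  (W_sub : forall z e, W (z, e) -> U z /\ e != 0)
  (W_slit : forall z e, W (z, e) -> forall g, Om g != 0 ->
     slit_plane (central_charge (F (phi z)) g / (two_pi_i * e)))
  (xi0 xi : Gam -> Cplx R) (theta : 'rV[Cplx R]_(d + d))
  (theta_xi : constant_term form b xi0 xi theta)
  (y : 'I_(d + d) -> 'rV[Cplx R]_(d + d) -> Cplx R -> Cplx R)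
  (y_def : y = y_fun form b Om L (fun u => central_charge (F (phi u))))
  (x : 'I_(d + d) -> 'rV[Cplx R]_(d + d) * 'rV[Cplx R]_(d + d) ->
       Cplx R -> Cplx R)
  (x_holomorphic : forall i z e, W (z, e) ->
     differentiable (x i ^~ e) (theta_section theta z))
  (x_restriction : forall i z e, W (z, e) ->
     x i (theta_section theta z) e = - e^-1 * z 0 i + y i z e)
  (tau : 'rV[Cplx R]_(d + d) -> Cplx R -> Cplx R)
  (tau_Joyce : Joyce_tau form b W x theta tau) :
  [/\ forall z e, W (z, e) ->
        has_dlog (tau ^~ e) z
          (fun v => e^-1 * \sum_(i < d)
             omega_mx R form b (lshift d i) (rshift d i) * z 0 (lshift d i)
             * 'd (y (rshift d i) ^~ e) z v),
      BPS_tau form b W y tau &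
      forall sigma, BPS_tau form b W y sigma ->
        exists2 c : Cplx R, c != 0 &
          forall z e, W (z, e) -> sigma z e = c * tau z e].
Proof.
have We z e : W (z, e) -> e != 0 by case/W_sub.
have L_diff w : slit_plane w -> differentiable L w by case/L_branch.
suff [dlog BPS] : (forall z e, W (z, e) ->
        has_dlog (tau ^~ e) z
          (fun v => e^-1 * \sum_(i < d)
             omega_mx R form b (lshift d i) (rshift d i) * z 0 (lshift d i)
             * 'd (y (rshift d i) ^~ e) z v)) /\ BPS_tau form b W y tau.
  split=> // sigma; exact: BPS_tau_unique.
have [tau0 [T tauT] tau_dlog] := tau_Joyce.
(* A point of [W] gives a point of [M], hence the finiteness of [Om]. *)
have [[[z0 e0] W0]|/forallNP W0] := pselect (exists w, W w); last first.
  split; first by move=> z e /W0.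
  by split=> [z e /W0|z e /W0|z e /W0|z e c _ /W0].
pose S := fset_set [set g | Om g != 0].
have S_active g : (g \in S) = (Om g != 0).
  have fin : finite_set [set g | Om g != 0].
    have := F_finite (phi z0); congr finite_set.
    by apply/funext => h; rewrite /= F_constant.
  by rewrite /S in_fset_set // mem_setE.
have [A A_span] : {A : Gam -> 'I_d -> int &
    forall g, g \in S -> g = \sum_i b (lshift d i) *~ A g i}.
  apply: (@choice _ _ (fun g a => g \in S -> g = \sum_i b (lshift d i) *~ a i)).
  move=> g; case: (boolP (g \in S)) => [|_]; last by exists (fun=> 0).
  by rewrite S_active; have [_ _ span] := b_adapted => /span [a ->]; exists a.
have dlog z e : W (z, e) ->
    has_dlog (tau ^~ e) z
      (fun v => e^-1 * \sum_(i < d)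
         omega_mx R form b (lshift d i) (rshift d i) * z 0 (lshift d i)
         * 'd (y (rshift d i) ^~ e) z v).
  move=> Wze; have [dtau dlogE] := tau_dlog z e Wze.
  split=> // v; rewrite dlogE.
  apply: (@pullback_Joyce_form _ _ _ form b W theta x y z e W_open Wze) => [i|i u Wu|k|k].
  - exact: x_holomorphic.
  - exact: x_restriction.
  - by rewrite y_def; exact: (y_loE L F phi form_skew b_adapted S_active A_span).
  - rewrite y_def; have [dy _] := is_diff_y_hi form_skew b_adapted phi_chart
      L_diff W_sub W_slit S_active A_span k Wze.
    exact: dy.
split; first exact: dlog.
have partial z e j : W (z, e) -> has_partial_log (tau ^~ e) j z
    (log_tau_form Om L S A e z (delta_mx 0 j)).
  move=> Wze; have [dtau dlogE] := dlog z e Wze.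
  split; first exact: diff_derivable.
  rewrite deriveE // dlogE y_def.
  exact: (sum_omega_dy form_skew b_adapted eta_invertible phi_chart
    L_diff W_sub W_slit S_active A_span).
split.
- exact: tau0.
- move=> z e Wze i; rewrite y_def.
  rewrite (omega_derive1_y form_skew b_adapted eta_invertible phi_chart
    L_diff W_sub W_slit S_active A_span) //.
  exact: partial.
- move=> z e Wze i; rewrite -(log_tau_form_hi Om L S A z e i).
  exact: partial.
- move=> z e c c0 W1 W2; rewrite (tauT _ _ W1) (tauT _ _ W2).
  by rewrite scalerA invfM mulrAC mulVf // mul1r.
Qed.
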